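(* Let $l>0$ and $c>0$. Let $(Q_{11},Q_{12},M_1,M_2)$ be any solution on $[-1,1]$ of the system $$l\, Q_{11}'' = 4 Q_{11}(Q_{11}^2 + Q_{12}^2 - 1) - c\left(M_1^2 - M_2^2 \right),$$ $$l\, Q_{12}'' = 4 Q_{12}(Q_{11}^2 + Q_{12}^2 - 1) - 2cM_1 M_2,$$ $$l\, M_1'' = M_1 \left(M_1^2 + M_2^2 - 1 \right) - 2c Q_{11}M_1 - 2c Q_{12}M_2,$$ $$l\, M_2'' = M_2 \left(M_1^2 + M_2^2 - 1 \right) + 2c Q_{11} M_2 - 2c Q_{12} M_1,$$ subject to the boundary conditions $Q_{11}(-1)=M_1(-1)=1$, $Q_{11}(1)=M_1(1)=-1$, $Q_{12}(\pm1)=M_2(\pm1)=0$. Then $$Q_{11}^2(y)+Q_{12}^2(y)\leq (\rho^* )^2,\qquad M_1^2(y)+M_2^2(y)\leq 1+2c\rho^*\qquad\text{for all } y\in[-1,1],$$ where $$\rho^*=\left(\frac{c}{8}+\sqrt{\frac{c^2}{64}-\frac{1}{27}\left(1+\frac{c^2}{2}\right)^3}\right)^{1/3}+\left(\frac{c}{8}-\sqrt{\frac{c^2}{64}-\frac{1}{27}\left(1+\frac{c^2}{2}\right)^3}\right)^{1/3}.$$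
   Context: Here $'$ denotes $\frac{\mathrm{d}}{\mathrm{d}y}$, all functions are real valued, and solutions are classical (twice continuously differentiable). In the formula for $\rho^*$ the quantity under the square root is negative for all $c\ge 0$; the two cube roots are the principal ones, which are complex conjugates of each other, so that $\rho^*$ is real; equivalently, $\rho^*=\rho^*(c)$ is the largest positive root of the cubic $\rho^3-\rho\left(1+\frac{c^2}{2}\right)-\frac{c}{4}$. *)

(* Defs.v *)
From Stdlib Require Import Reals Lra Psatz.
From Coquelicot Require Import Coquelicot.

Open Scope R_scope.

(** Principal argument, with values in (-PI, PI] for [z <> 0]. *)
Definition Carg (z : C) : R :=
  if Rle_dec 0 (Im z) then acos (Re z / Cmod z) else - acos (Re z / Cmod z).

(** Principal [n]-th root.  The root of [0] is set apart because
    [Rpower 0 x] is not [0]. *)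
Definition Croot (n : nat) (z : C) : C :=
  if Ceq_dec z (RtoC 0) then RtoC 0
  else
    let r := Rpower (Cmod z) (/ INR n) in
    let t := Carg z / INR n in
    (r * cos t, r * sin t).

Definition rho_rad (c : R) : R := c ^ 2 / 64 - / 27 * (1 + c ^ 2 / 2) ^ 3.

Definition rho_starC (c : R) : C :=
  (Croot 3 (RtoC (c / 8) + Croot 2 (RtoC (rho_rad c)))
   + Croot 3 (RtoC (c / 8) - Croot 2 (RtoC (rho_rad c))))%C.

(** [rho_starC c] is real, see [rho_starC_real]. *)
Definition rho_star (c : R) : R := Re (rho_starC c).

Definition on_pm1 (y : R) : Prop := -1 <= y <= 1.

(** [f] is twice continuously differentiable on the set [D], with second
    derivative [f2]; derivatives are relative to [D], hence one-sided at the
    endpoints of a closed interval. *)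
Definition C2_with_derive2 (D : R -> Prop) (f f2 : R -> R) : Prop :=
  exists f1 : R -> R,
    (forall y, D y -> D_in f f1 D y) /\
    (forall y, D y -> D_in f1 f2 D y) /\
    (forall y, D y -> continue_in f2 D y).

Definition is_solution (l c : R) (Q11 Q12 M1 M2 : R -> R) : Prop :=
  exists Q11'' Q12'' M1'' M2'' : R -> R,
    C2_with_derive2 on_pm1 Q11 Q11'' /\
    C2_with_derive2 on_pm1 Q12 Q12'' /\
    C2_with_derive2 on_pm1 M1 M1'' /\
    C2_with_derive2 on_pm1 M2 M2'' /\
    forall y, on_pm1 y ->
      l * Q11'' y =
        4 * Q11 y * (Q11 y ^ 2 + Q12 y ^ 2 - 1) - c * (M1 y ^ 2 - M2 y ^ 2) /\
      l * Q12'' y =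
        4 * Q12 y * (Q11 y ^ 2 + Q12 y ^ 2 - 1) - 2 * c * M1 y * M2 y /\
      l * M1'' y =
        M1 y * (M1 y ^ 2 + M2 y ^ 2 - 1)
        - 2 * c * Q11 y * M1 y - 2 * c * Q12 y * M2 y /\
      l * M2'' y =
        M2 y * (M1 y ^ 2 + M2 y ^ 2 - 1)
        + 2 * c * Q11 y * M2 y - 2 * c * Q12 y * M1 y.

Definition boundary_conditions (Q11 Q12 M1 M2 : R -> R) : Prop :=
  Q11 (-1) = 1 /\ M1 (-1) = 1 /\
  Q11 1 = -1 /\ M1 1 = -1 /\
  Q12 (-1) = 0 /\ Q12 1 = 0 /\
  M2 (-1) = 0 /\ M2 1 = 0.

Lemma rho_rad_neg (c : R) : rho_rad c < 0.
Proof.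
unfold rho_rad.
assert (H : 0 <= c ^ 2) by apply pow2_ge_0.
set (x := c ^ 2) in *; clearbody x.
assert (H2 : 0 <= x * x) by nra.
assert (H3 : 0 <= x * (x * x)) by nra.
nra.
Qed.

Lemma Croot2_neg (d : R) : d < 0 -> Croot 2 (RtoC d) = (0, sqrt (- d)).
Proof.
intros Hd; unfold Croot.
destruct (Ceq_dec (RtoC d) (RtoC 0)) as [E|_].
  apply RtoC_inj in E; lra.
unfold Carg.
replace (Im (RtoC d)) with 0 by reflexivity.
replace (Re (RtoC d)) with d by reflexivity.
destruct (Rle_dec 0 0) as [_|N]; [|lra].
rewrite Cmod_R, Rabs_left by lra.
replace (d / - d) with (- (1)) by (field; lra).
rewrite acos_opp, acos_1, Rminus_0_r; simpl INR.
replace (1 + 1) with 2 by ring.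
rewrite cos_PI2, sin_PI2, Rmult_0_r, Rmult_1_r.
rewrite Rpower_sqrt by lra; reflexivity.
Qed.

Lemma Croot_conj (n : nat) (z : C) :
  Im z <> 0 -> Croot n (Cconj z) = Cconj (Croot n z).
Proof.
intros Hz; unfold Croot.
destruct (Ceq_dec z (RtoC 0)) as [E|_]; [rewrite E in Hz; simpl in Hz; lra|].
destruct (Ceq_dec (Cconj z) (RtoC 0)) as [E|_].
  apply (f_equal Im) in E; simpl in E; unfold Im in Hz; lra.
assert (HA : Carg (Cconj z) = - Carg z).
  unfold Carg; rewrite Cmod_conj; unfold Re, Im in *; simpl.
  destruct (Rle_dec 0 (- snd z)), (Rle_dec 0 (snd z)); lra.
rewrite HA, Cmod_conj; unfold Cconj; simpl.
rewrite Rdiv_opp_l, cos_neg, sin_neg; f_equal; ring.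
Qed.

Lemma rho_starC_real (c : R) : rho_starC c = RtoC (rho_star c).
Proof.
assert (Hn := rho_rad_neg c).
unfold rho_star, rho_starC; rewrite (Croot2_neg _ Hn).
assert (Hs : 0 < sqrt (- rho_rad c)) by (apply sqrt_lt_R0; lra).
set (s := sqrt _) in *; clearbody s.
set (z := (RtoC (c / 8) + (0, s))%C).
replace (RtoC (c / 8) - (0, s))%C with (Cconj z).
2: { unfold z, Cconj, Cminus, Cplus, Copp, RtoC; simpl; f_equal; ring. }
rewrite Croot_conj by (unfold z, Im; simpl; lra).
unfold Cplus, Cconj, RtoC, Re; simpl; f_equal; ring.
Qed.

(* Main.v *)
Require Import Defs.
From Stdlib Require Import Reals Lra Psatz.
From Coquelicot Require Import Coquelicot.
Open Scope R_scope.

(** Put [A = |Q|^2], [B = |M|^2] and let [r^2], [b] be their maxima.  Where [B]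
    has an interior maximum, [M . M'' <= 0] and Cauchy-Schwarz give
    [b <= 1 + 2 c r]; where [A] has an interior maximum, [Q . Q'' <= 0] gives
    [4 r (r^2 - 1) <= c b].  Together, [r^3 - (1 + c^2/2) r - c/4 <= 0], so that
    [r] is at most the unique positive root [rho*] of this cubic.  At the
    endpoints [A = B = 1], which is harmless because [rho* > 1]. *)

(** * Second-order condition at a maximum of a squared norm *)

(** Turns the relative derivatives of [C2_with_derive2] into ordinary ones away from the
    endpoints. *)
Lemma D_in_is_derive (D : R -> Prop) (f f1 : R -> R) (x : R) :
  locally x D -> D_in f f1 D x -> is_derive f x (f1 x).
Proof.
intros [d Hd] Hf; apply is_derive_Reals; intros eps Heps.
destruct (Hf eps Heps) as [a [Ha H]].
assert (Hm : 0 < Rmin d a) by (apply Rmin_pos; [apply cond_pos | lra]).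
exists (mkposreal _ Hm); simpl; intros h Hh0 Hh.
assert (Hhd : Rabs h < d) by (apply Rlt_le_trans with (1 := Hh), Rmin_l).
assert (Hha : Rabs h < a) by (apply Rlt_le_trans with (1 := Hh), Rmin_r).
specialize (H (x + h)); simpl in H; unfold Rdist, D_x in H.
replace (x + h - x) with h in H by ring.
apply H; repeat split; try lra.
apply Hd; change (Rabs (x + h - x) < d).
now replace (x + h - x) with h by ring.
Qed.

(** Since [g1 x = 0], a positive [g2] would make [g1] positive just to the right of [x], and the
    mean value theorem would push [g] above [g x] there. *)
Lemma local_max_derive2_le0 (g g1 : R -> R) (x g2 : R) :
  locally x (fun y => is_derive g y (g1 y)) -> is_derive g1 x g2 ->
  locally x (fun y => g y <= g x) -> g2 <= 0.
Proof.
intros Hg Hg1 Hmax.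
destruct (filter_and _ _ Hg Hmax) as [d Hd].
assert (Hball : forall y, Rabs (y - x) < d -> is_derive g y (g1 y) /\ g y <= g x).
{ intros y Hy; exact (Hd y Hy). }
assert (Hdp := cond_pos d).
assert (H0 : g1 x = 0).
{ assert (Hx : derivable_pt_lim g x (g1 x)).
  { apply is_derive_Reals, Hball; rewrite Rminus_diag, Rabs_R0; lra. }
  rewrite <- (derive_pt_eq_0 g x (g1 x) (exist _ _ Hx) Hx).
  apply deriv_maximum with (x - d) (x + d); try lra.
  intros y Hy1 Hy2; apply Hball, Rabs_def1; lra. }
destruct (Rle_or_lt g2 0) as [|Hpos]; [assumption|exfalso].
apply is_derive_Reals in Hg1.
destruct (Hg1 g2 Hpos) as [e He].
assert (Hep := cond_pos e).
set (h := Rmin d e / 2).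
assert (Hmin : 0 < Rmin d e) by (apply Rmin_pos; lra).
assert (Hmd := Rmin_l d e); assert (Hme := Rmin_r d e).
destruct (MVT_cor2 g g1 x (x + h)) as [z [Hz1 Hz2]]; [unfold h; lra| |].
{ intros y Hy; apply is_derive_Reals, Hball, Rabs_def1; unfold h in Hy; lra. }
assert (Hgz : 0 < g1 z).
{ specialize (He (z - x)).
  replace (x + (z - x)) with z in He by ring.
  rewrite H0, Rminus_0_r in He.
  assert (Hq : Rabs (g1 z / (z - x) - g2) < g2).
  { apply He; [lra|]; apply Rabs_def1; unfold h in Hz2; lra. }
  apply Rabs_def2 in Hq.
  replace (g1 z) with (g1 z / (z - x) * (z - x)) by (field; lra).
  apply Rmult_lt_0_compat; lra. }
assert (Hm : g (x + h) <= g x) by (apply Hball, Rabs_def1; unfold h; lra).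
assert (0 < g1 z * (x + h - x)) by (apply Rmult_lt_0_compat; unfold h; lra).
lra.
Qed.

(** Half the second derivative of [f ^ 2 + g ^ 2] is the expression in the conclusion plus
    [f1 ^ 2 + g1 ^ 2], so its sign at a maximum passes to the conclusion. *)
Lemma interior_max_sqr_norm (D : R -> Prop) (f f2 g g2 : R -> R) (x : R) :
  C2_with_derive2 D f f2 -> C2_with_derive2 D g g2 -> locally x D ->
  (forall y, D y -> f y ^ 2 + g y ^ 2 <= f x ^ 2 + g x ^ 2) ->
  f x * f2 x + g x * g2 x <= 0.
Proof.
intros [f1 [Hf [Hf1 _]]] [g1 [Hg [Hg1 _]]] HD Hmax.
assert (HDx : D x) by (apply locally_singleton, HD).
assert (H : 2 * (f1 x ^ 2 + f x * f2 x + g1 x ^ 2 + g x * g2 x) <= 0).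
{ apply (local_max_derive2_le0 (fun y => f y ^ 2 + g y ^ 2)
           (fun y => 2 * (f y * f1 y + g y * g1 y)) x).
  - generalize (locally_locally _ _ HD); apply filter_imp; intros y HDy.
    assert (Dy : D y) by (apply locally_singleton, HDy).
    assert (Hfy := D_in_is_derive D f f1 y HDy (Hf y Dy)).
    assert (Hgy := D_in_is_derive D g g1 y HDy (Hg y Dy)).
    auto_derive; [repeat split; eexists; eassumption|].
    replace (Derive (fun z => f z) y) with (f1 y)
      by (symmetry; apply is_derive_unique, Hfy).
    replace (Derive (fun z => g z) y) with (g1 y)
      by (symmetry; apply is_derive_unique, Hgy).
    ring.
  - assert (Hfx := D_in_is_derive D f f1 x HD (Hf x HDx)).
    assert (Hgx := D_in_is_derive D g g1 x HD (Hg x HDx)).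
    assert (Hfx1 := D_in_is_derive D f1 f2 x HD (Hf1 x HDx)).
    assert (Hgx1 := D_in_is_derive D g1 g2 x HD (Hg1 x HDx)).
    auto_derive; [repeat split; eexists; eassumption|].
    replace (Derive (fun z => f z) x) with (f1 x)
      by (symmetry; apply is_derive_unique, Hfx).
    replace (Derive (fun z => g z) x) with (g1 x)
      by (symmetry; apply is_derive_unique, Hgx).
    replace (Derive (fun z => f1 z) x) with (f2 x)
      by (symmetry; apply is_derive_unique, Hfx1).
    replace (Derive (fun z => g1 z) x) with (g2 x)
      by (symmetry; apply is_derive_unique, Hgx1).
    ring.
  - revert HD; apply filter_imp; exact Hmax. }
nra.
Qed.

(* [continuity_ab_maj] wants two-sided continuity at the endpoints, hence the
   precomposition with the projection onto [a, b]. *)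
Lemma continue_in_max (a b : R) (f : R -> R) :
  a <= b -> (forall y, a <= y <= b -> continue_in f (fun z => a <= z <= b) y) ->
  exists x, a <= x <= b /\ forall y, a <= y <= b -> f y <= f x.
Proof.
intros Hab Hf.
set (p := fun y => Rmax a (Rmin b y)).
assert (Hp : forall y, a <= p y <= b).
{ intros y; unfold p, Rmax, Rmin; repeat destruct Rle_dec; lra. }
assert (Hpid : forall y, a <= y <= b -> p y = y).
{ intros y Hy; unfold p, Rmax, Rmin; repeat destruct Rle_dec; lra. }
destruct (continuity_ab_maj (fun y => f (p y)) a b Hab) as [x [Hx Hxab]].
- intros y _ eps Heps.
  destruct (Hf (p y) (Hp y) eps Heps) as [d [Hd H]].
  exists d; split; [exact Hd|]; intros z [_ Hz].
  (* [continue_in] only tests points other than the base point, so the case where the projection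
     identifies [y] and [z] is separate. *)
  destruct (Req_dec (p y) (p z)) as [E|E].
  { rewrite <- E; simpl; rewrite Rdist_eq; exact Heps. }
  apply (H (p z)); split; [split; [apply Hp|exact E]|].
  apply Rle_lt_trans with (2 := Hz); simpl; unfold Rdist.
  unfold p, Rmax, Rmin; repeat destruct Rle_dec; unfold Rabs;
    repeat destruct Rcase_abs; lra.
- exists x; split; [exact Hxab|]; intros y Hy.
  specialize (Hx y Hy); now rewrite !Hpid in Hx.
Qed.

Lemma sqr_norm_max (a b : R) (f f2 g g2 : R -> R) :
  a <= b -> C2_with_derive2 (fun y => a <= y <= b) f f2 ->
  C2_with_derive2 (fun y => a <= y <= b) g g2 ->
  exists x, a <= x <= b /\
    (forall y, a <= y <= b -> f y ^ 2 + g y ^ 2 <= f x ^ 2 + g x ^ 2) /\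
    (x = a \/ x = b \/ f x * f2 x + g x * g2 x <= 0).
Proof.
intros Hab Hf Hg.
destruct (continue_in_max a b (fun y => f y ^ 2 + g y ^ 2) Hab) as [x [Hx Hmax]].
- intros y Hy.
  destruct Hf as [f1 [Hf _]], Hg as [g1 [Hg _]].
  assert (Cf := cont_deriv _ _ _ _ (Hf y Hy)).
  assert (Cg := cont_deriv _ _ _ _ (Hg y Hy)).
  (* [simpl] turns each square into [u * (u * 1)]; [limit_free] deals with the constant factor 1. *)
  apply limit_plus; simpl; repeat apply limit_mul; trivial;
    apply (limit_free (fun _ => 1) _ 0).
- exists x; split; [exact Hx|]; split; [exact Hmax|].
  destruct (Req_dec x a) as [|Ha]; [tauto|].
  destruct (Req_dec x b) as [|Hb]; [tauto|].
  right; right; apply (interior_max_sqr_norm _ f f2 g g2 x Hf Hg); [|exact Hmax].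
  apply (locally_interval _ x a b); simpl; try lra.
  intros y; simpl; lra.
Qed.

(** * The radical formula and the cubic *)

Lemma cos_3x (t : R) : cos (3 * t) = 4 * cos t ^ 3 - 3 * cos t.
Proof.
replace (3 * t) with (2 * t + t) by ring.
rewrite cos_plus, cos_2a_cos, sin_2a.
assert (H := sin2_cos2 t); unfold Rsqr in H.
replace (2 * cos t * cos t - 1) with (2 * cos t ^ 2 - 1) by ring.
replace (2 * sin t * cos t * sin t) with (2 * (sin t * sin t) * cos t) by ring.
replace (sin t * sin t) with (1 - cos t * cos t) by lra; ring.
Qed.

(** Polar form: since [0 < s], the principal argument is an [acos], hence in [[0, PI]], and its
    third [t] has positive cosine. *)
Lemma Croot3_pos_im (a s : R) : 0 <= a -> 0 < s ->
  exists r t : R, Croot 3 (a, s) = (r * cos t, r * sin t) /\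
    0 < r /\ 0 < cos t /\ r ^ 3 * cos (3 * t) = a /\ (r ^ 2) ^ 3 = a ^ 2 + s ^ 2.
Proof.
intros Ha Hs.
set (z := (a, s) : C).
assert (Hz : z <> RtoC 0).
{ intros E; apply (f_equal Im) in E; simpl in E; lra. }
assert (Hm : 0 < Cmod z) by (apply Cmod_gt_0, Hz).
assert (Hm2 : Cmod z ^ 2 = a ^ 2 + s ^ 2).
{ unfold Cmod; simpl fst; simpl snd; rewrite pow2_sqrt; [reflexivity|nra]. }
assert (Ham : 0 <= a / Cmod z) by (apply Rdiv_le_0_compat; lra).
assert (Ham1 : a / Cmod z <= 1).
{ apply Rle_div_l; [lra|]; nra. }
assert (Hr : Rpower (Cmod z) (/ 3) ^ 3 = Cmod z).
{ rewrite <- Rpower_pow by apply exp_pos.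
  rewrite Rpower_mult.
  replace (/ 3 * INR 3) with 1 by (simpl; field).
  exact (Rpower_1 _ Hm). }
exists (Rpower (Cmod z) (/ 3)), (acos (a / Cmod z) / 3).
repeat split.
- unfold Croot; destruct (Ceq_dec z (RtoC 0)) as [E|_]; [contradiction|].
  unfold Carg; change (Im z) with s; change (Re z) with a.
  destruct (Rle_dec 0 s) as [_|N]; [|lra].
  replace (INR 3) with 3 by (simpl; ring); reflexivity.
- apply exp_pos.
- assert (B := acos_bound (a / Cmod z)); assert (P := PI_RGT_0).
  apply cos_gt_0; lra.
- rewrite Hr.
  replace (3 * (acos (a / Cmod z) / 3)) with (acos (a / Cmod z)) by field.
  rewrite cos_acos by lra; field; lra.
- rewrite <- Hm2, <- pow_mult.
  change (2 * 3)%nat with (3 * 2)%nat.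
  now rewrite pow_mult, Hr.
Qed.

(** The two cube roots are conjugate, so [rho_star c = 2 * r * cos t]. With
    [r ^ 2 = (1 + c ^ 2 / 2) / 3] and [r ^ 3 * cos (3 * t) = c / 8], the cubic is the triple-angle
    identity. *)
Lemma rho_star_pos_root (c : R) : 0 <= c ->
  0 < rho_star c /\ rho_star c ^ 3 - rho_star c * (1 + c ^ 2 / 2) - c / 4 = 0.
Proof.
intros Hc.
assert (Hn := rho_rad_neg c).
unfold rho_star, rho_starC; rewrite (Croot2_neg _ Hn).
assert (Hs : 0 < sqrt (- rho_rad c)) by (apply sqrt_lt_R0; lra).
assert (Hs2 : sqrt (- rho_rad c) ^ 2 = - rho_rad c) by (apply pow2_sqrt; lra).
set (s := sqrt _) in *; clearbody s.
replace (RtoC (c / 8) + (0, s))%C with ((c / 8, s) : C).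
2: { unfold Cplus, RtoC; simpl; f_equal; ring. }
replace (RtoC (c / 8) - (0, s))%C with (Cconj (c / 8, s)).
2: { unfold Cconj, Cminus, Cplus, Copp, RtoC; simpl; f_equal; ring. }
rewrite Croot_conj by (simpl; lra).
destruct (Croot3_pos_im (c / 8) s) as [r [t [-> [Hr [Ht [H3 H6]]]]]]; [lra|lra|].
unfold Re, Cplus, Cconj; simpl fst.
rewrite Hs2 in H6; unfold rho_rad in H6.
assert (Hr2 : r ^ 2 = (1 + c ^ 2 / 2) / 3).
{ set (q := (1 + c ^ 2 / 2) / 3).
  assert (Hq : 0 < q) by (unfold q; nra).
  (* The squared modulus is [(c / 8) ^ 2 - rho_rad c], where the terms [c ^ 2 / 64] cancel and leave
     a perfect cube. *)
  assert (E : (r ^ 2) ^ 3 = q ^ 3) by (rewrite H6; unfold q; field).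
  assert (Hrr : 0 < r ^ 2) by nra.
  set (w := r ^ 2) in *; clearbody w q.
  assert (E' : (w - q) * (w ^ 2 + w * q + q ^ 2) = 0) by (ring_simplify; lra).
  apply Rmult_integral in E'; destruct E' as [E'|E']; [lra|nra]. }
rewrite cos_3x in H3; split; [nra|].
replace (1 + c ^ 2 / 2) with (3 * r ^ 2) by lra.
replace c with (8 * (r ^ 3 * (4 * cos t ^ 3 - 3 * cos t))) at 1 by lra.
field.
Qed.

(** At the root [q], [q * (q ^ 2 - p) = c / 4 > 0], so [q ^ 2 > p]; beyond [q] both factors of
    [r * (r ^ 2 - p)] grow and the cubic is positive. *)
Lemma le_rho_star (c r : R) : 0 < c ->
  r ^ 3 - r * (1 + c ^ 2 / 2) - c / 4 <= 0 -> r <= rho_star c.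
Proof.
intros Hc Hr.
destruct (rho_star_pos_root c (Rlt_le _ _ Hc)) as [Hp Hroot].
set (q := rho_star c) in *; clearbody q.
set (p := 1 + c ^ 2 / 2) in *; clearbody p.
apply Rnot_lt_le; intros Hlt.
assert (Hqp : 0 < q ^ 2 - p) by nra.
assert (0 < r ^ 2 - q ^ 2) by nra.
nra.
Qed.

(* The coupling term is [Re (conj Q * M^2)] for [Q = q1 + i q2], [M = m1 + i m2]. *)
Lemma coupling_le (q1 q2 m1 m2 r : R) :
  0 <= r -> q1 ^ 2 + q2 ^ 2 <= r ^ 2 ->
  q1 * (m1 ^ 2 - m2 ^ 2) + 2 * q2 * m1 * m2 <= r * (m1 ^ 2 + m2 ^ 2).
Proof.
intros Hr Hq.
apply Rsqr_incr_0_var; [|nra].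
apply Rle_trans with ((q1 ^ 2 + q2 ^ 2) * (m1 ^ 2 + m2 ^ 2) ^ 2).
(* Lagrange's identity: the term discarded is the square of [Im (conj Q * M^2)]. *)
- assert (0 <= (q1 * (2 * m1 * m2) - q2 * (m1 ^ 2 - m2 ^ 2)) ^ 2) by apply pow2_ge_0.
  unfold Rsqr; lra.
- replace (Rsqr (r * (m1 ^ 2 + m2 ^ 2))) with (r ^ 2 * (m1 ^ 2 + m2 ^ 2) ^ 2)
    by (unfold Rsqr; ring).
  apply Rmult_le_compat_r; [apply pow2_ge_0|exact Hq].
Qed.

Theorem theorem2p3 (l c : R) (hl : 0 < l) (hc : 0 < c)
  (Q11 Q12 M1 M2 : R -> R)
  (hsol : is_solution l c Q11 Q12 M1 M2)
  (hbc : boundary_conditions Q11 Q12 M1 M2) :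
  forall y : R, -1 <= y <= 1 ->
    Q11 y ^ 2 + Q12 y ^ 2 <= rho_star c ^ 2 /\
    M1 y ^ 2 + M2 y ^ 2 <= 1 + 2 * c * rho_star c.
Proof.
destruct hsol as [q1 [q2 [m1 [m2 [HQ1 [HQ2 [HM1 [HM2 Heq]]]]]]]].
destruct hbc as [a1 [a2 [a3 [a4 [a5 [a6 [a7 a8]]]]]]].
destruct (sqr_norm_max (-1) 1 Q11 q1 Q12 q2) as [x [Hx [HA HxA]]]; trivial; [lra|].
destruct (sqr_norm_max (-1) 1 M1 m1 M2 m2) as [z [Hz [HB HzB]]]; trivial; [lra|].
set (A := Q11 x ^ 2 + Q12 x ^ 2) in *.
set (B := M1 z ^ 2 + M2 z ^ 2) in *.
set (r := sqrt A).
assert (HA0 : 0 <= A) by (unfold A; nra).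
assert (Hr0 : 0 <= r) by apply sqrt_pos.
assert (Hr2 : r ^ 2 = A) by (apply pow2_sqrt; exact HA0).
assert (HB0 : 0 <= B) by (unfold B; nra).
assert (HBr : B <= 1 + 2 * c * r).
{ assert (Hcr : 0 <= c * r) by nra.
  destruct HzB as [E|[E|HzB]].
  - unfold B; rewrite E, a2, a7; lra.
  - unfold B; rewrite E, a4, a8; lra.
  - destruct (Heq z Hz) as [_ [_ [E1 E2]]].
    assert (K := coupling_le (Q11 z) (Q12 z) (M1 z) (M2 z) r Hr0).
    rewrite Hr2 in K; specialize (K (HA z Hz)); fold B in K.
    assert (S : l * (M1 z * m1 z + M2 z * m2 z) <= 0) by nra.
    replace (l * (M1 z * m1 z + M2 z * m2 z))
      with (M1 z * (l * m1 z) + M2 z * (l * m2 z)) in S by ring.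
    rewrite E1, E2 in S; fold B in S.
    assert (T : B * (B - 1) <= 2 * c * (r * B)).
    { apply Rle_trans with (2 * c * (Q11 z * (M1 z ^ 2 - M2 z ^ 2)
        + 2 * Q12 z * M1 z * M2 z)).
      - apply Rminus_le; eapply Rle_trans; [right|exact S]; unfold B; ring.
      - apply Rmult_le_compat_l; lra. }
    (* Division of [T] by [B]; for [B = 0] the bound follows from [0 <= c * r]. *)
    destruct (Req_dec B 0); nra. }
assert (Hcub : r ^ 3 - r * (1 + c ^ 2 / 2) - c / 4 <= 0).
(* At [r = 1] the cubic equals [- c ^ 2 / 2 - c / 4]. *)
{ assert (Hbd : A = 1 -> r ^ 3 - r * (1 + c ^ 2 / 2) - c / 4 <= 0).
  { intros E; assert (r = 1) as -> by (unfold r; rewrite E; apply sqrt_1); nra. }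
  destruct HxA as [E|[E|HxA]].
  - apply Hbd; unfold A; rewrite E, a1, a5; ring.
  - apply Hbd; unfold A; rewrite E, a3, a6; ring.
  - destruct (Heq x Hx) as [E1 [E2 _]].
    assert (K := coupling_le (Q11 x) (Q12 x) (M1 x) (M2 x) r Hr0).
    rewrite Hr2 in K; specialize (K (Rle_refl _)).
    assert (S : l * (Q11 x * q1 x + Q12 x * q2 x) <= 0) by nra.
    replace (l * (Q11 x * q1 x + Q12 x * q2 x))
      with (Q11 x * (l * q1 x) + Q12 x * (l * q2 x)) in S by ring.
    rewrite E1, E2 in S; fold A in S.
    (* The maxima may sit at different points, so [|M|^2] at [x] is bounded by its maximum [B]. *)
    assert (T : 4 * A * (A - 1) <= c * (r * B)).
    { apply Rle_trans with (c * (Q11 x * (M1 x ^ 2 - M2 x ^ 2)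
        + 2 * Q12 x * M1 x * M2 x)).
      - apply Rminus_le; eapply Rle_trans; [right|exact S]; unfold A; ring.
      - apply Rmult_le_compat_l; [lra|]; specialize (HB x Hx); nra. }
    (* [T] is about to be divided by [r]; at [r = 0] the cubic is just [- c / 4]. *)
    destruct (Rle_lt_or_eq_dec 0 r Hr0) as [Hrp|E0]; [|rewrite <- E0; nra].
    rewrite <- Hr2 in T.
    assert (U : r * (4 * r * (r ^ 2 - 1) - c * B) <= 0) by lra.
    assert (U' : 4 * r * (r ^ 2 - 1) - c * B <= 0) by nra.
    assert (c * B <= c * (1 + 2 * c * r)) by (apply Rmult_le_compat_l; lra).
    (* Inserting the bound on [B] into [U'] gives four times the cubic. *)
    nra. }
assert (Hle := le_rho_star c r hc Hcub).
intros y Hy; split.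
- apply Rle_trans with (1 := HA y Hy); rewrite <- Hr2; apply pow_incr; lra.
- apply Rle_trans with (1 := HB y Hy); nra.
Qed.
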